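(* Let $\Lambda_0,\Lambda_1,\dots,\Lambda_m$ be active partitions up to depth $N$, and suppose that for each $j=1,\dots,m$ there exists $w_j\in\Lambda_{j-1}$ with $|w_j|<N$ such that $\Lambda_j=\Lambda_{j-1}[w_j]$. Then for every $A\in\mathcal{S}_2\cap B(H)_+$, $$M_{\Lambda_0}(A)-M_{\Lambda_m}(A)=\sum_{j=1}^m\delta_{w_j}(A).$$ Equivalently, $$M_{\Lambda_0}(A)-M_{\Lambda_m}(A)=\sum_{j=1}^m\ \sum_{\substack{v,v'\in\mathrm{ch}(w_j)\\ v\ne v'}}\mathrm{tr}\left(C_v(A)C_{v'}(A)\right),$$ the inner sums being over ordered pairs.
   Context: $H$ is a Hilbert space and $B(H)_+$ is the set of bounded positive operators on $H$; $\mathcal{S}_2$ is the Hilbert-Schmidt (HS) class with norm $\|\cdot\|_2$. $\mathcal{T}$ is a rooted finitely branching tree with root $\emptyset$; $|w|$ denotes the depth of a node $w$ and $\mathrm{ch}(w)$ the finite set of children of $w$. $\{W_w\}_{w\in\mathcal{T}}$ is a family of closed subspaces of $H$ with orthogonal projections $P_w$ such that: for each $n\ge 0$, $H=\bigoplus_{|w|=n}W_w$ (orthogonal sum), so $I=\sum_{|w|=n}P_w$; and for each node $w$, $W_w=\bigoplus_{v\in\mathrm{ch}(w)}W_v$ (orthogonal sum), i.e. $P_w=\sum_{v\in\mathrm{ch}(w)}P_v$ with $P_vP_{v'}=0$ for distinct $v,v'\in\mathrm{ch}(w)$. For $A\in B(H)_+$, $C_w(A)=A^{1/2}P_wA^{1/2}$.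 Fix a terminal depth $N\ge 1$. A finite set $\Lambda\subset\mathcal{T}$ is an active partition up to depth $N$ if (1) each $w\in\Lambda$ satisfies $|w|\le N$; (2) $\Lambda$ is an antichain (no node of $\Lambda$ is a proper ancestor of another); (3) every node $z\in\mathcal{T}$ with $|z|=N$ has a unique ancestor in $\Lambda$ (a node counts as its own ancestor). For $w\in\Lambda$ with $|w|<N$, the refinement of $\Lambda$ at $w$ is $\Lambda[w]=(\Lambda\setminus\{w\})\cup\mathrm{ch}(w)$. For $A\in\mathcal{S}_2\cap B(H)_+$, define $M_\Lambda(A)=\sum_{w\in\Lambda}\|C_w(A)\|_2^2$ and, for a node $w$ with $|w|<N$, $\delta_w(A)=\|C_w(A)\|_2^2-\sum_{v\in\mathrm{ch}(w)}\|C_v(A)\|_2^2$. *)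

(* Defs.v *)
From HB Require Import structures.
From mathcomp Require Import all_boot all_order all_algebra finmap complex.
From mathcomp Require Import all_classical all_reals all_analysis.
From mathcomp.analysis.showcase Require summability.

Set Implicit Arguments.
Unset Strict Implicit.
Unset Printing Implicit Defensive.
Import Order.TTheory GRing.Theory Num.Theory.
Import numFieldNormedType.Exports.
Local Open Scope classical_set_scope.
Local Open Scope ring_scope.
Local Open Scope complex_scope.

(* Complex Hilbert spaces, not assumed separable.  The inner product is linear
   in its first argument and conjugate-linear in the second. *)
Record hilbertType (R : realType) := HilbertType {
  hilbert_space :> completeNormedModType R[i];
  ip : {dot hilbert_space for (@Num.conj R[i])};
  ip_norm : forall x : hilbert_space, `|x| ^+ 2 = ip x x }.

Section HilbertSpace.
Variables (R : realType) (H : hilbertType R).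
Implicit Types (x y : H) (U E : set H) (A B T : H -> H).

Definition closed_subspace U :=
  [/\ U 0, (forall (a : R[i]) x y, U x -> U y -> U (a *: x + y)) & closed U].

Definition proj U x : H :=
  xget 0 [set y | U y /\ forall z, U z -> ip H (x - y) z = 0].

(* U is the orthogonal direct sum of the finitely many subspaces W i, i in I *)
Definition orth_sum (I : choiceType) (s : {fset I}) (W : I -> set H) U :=
  (forall i j, i \in s -> j \in s -> i != j ->
     forall x y, W i x -> W j y -> ip H x y = 0) /\
  U = [set x | exists y : I -> H,
         (forall i, i \in s -> W i (y i)) /\ x = \sum_(i <- s) y i].

Definition bounded_op A :=
  (forall (a : R[i]) x y, A (a *: x + y) = a *: A x + A y) /\
  exists M : R[i], forall x, `|A x| <= M * `|x|.

(* [0 <= z] in R[i] means that z is real and nonnegative. *)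
Definition positive_op A := bounded_op A /\ forall x, 0 <= ip H (A x) x.

(* For a positive A, the set below is a singleton. *)
Definition sqrt_op A : H -> H :=
  xget (fun=> 0) [set B | positive_op B /\ B \o B = A].

Definition orthonormal_set E :=
  (forall e, E e -> ip H e e = 1) /\
  (forall e f, E e -> E f -> e != f -> ip H e f = 0).

Definition hilbert_basis E :=
  orthonormal_set E /\ forall x, (forall e, E e -> ip H x e = 0) -> x = 0.

Lemma hilbert_basis_exists : exists E : set H, hilbert_basis E.
Proof.
have [F FE totF|E [Eo Emax]] := @Zorn_bigcup H orthonormal_set.
  split=> [e [X FX Xe]|e f [X FX Xe] [Y FY Yf] ef]; first exact: (FE _ FX).1 _ Xe.
  have [XY|YX] := totF _ _ FX FY.
    exact: (FE _ FY).2 _ _ (XY _ Xe) Yf ef.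
  exact: (FE _ FX).2 _ _ Xe (YX _ Yf) ef.
exists E; split=> // x xE; apply/eqP; apply: contrapT => /negP x0.
have nx0 : `|x| != 0 :> R[i] by rewrite normr_eq0.
pose u := `|x|^-1 *: x.
have uE e : E e -> ip H u e = 0 by move=> Ee; rewrite linearZl_LR /= xE // mulr0.
have Eu e : E e -> ip H e u = 0.
  by move=> Ee; rewrite hermC [X in _ * _ X](uE e Ee) rmorph0 mulr0.
have uu : ip H u u = 1.
  by rewrite -ip_norm normrZ normfV normr_id mulVf // expr1n.
have nEu : ~ E u by move=> /uE; rewrite uu => /eqP; rewrite oner_eq0.
apply: (Emax (E `|` [set u])).
  by split=> [y Ey|EuE]; [left|apply: nEu; apply: EuE; right].
split=> [e [Ee|->]|e f [Ee|->] [Ef|->]] //.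
- exact: Eo.1.
- exact: Eo.2.
- by move=> _; apply: Eu.
- by move=> _; apply: uE.
- by rewrite eqxx.
Qed.

Definition std_basis : set H := projT1 (cid hilbert_basis_exists).

(* The values below do not depend on the choice of the Hilbert basis. *)
Definition hs_norm2 A : \bar R :=
  \esum_(e in std_basis) (complex.Re (`|A e| ^+ 2))%:E.

Definition hilbert_schmidt A := bounded_op A /\ (hs_norm2 A < +oo)%E.

Definition hs_norm A : R := Num.sqrt (fine (hs_norm2 A)).

(* Unconditional sum of the <T e, e>, i.e. the limit along the directed set of
   finite subsets of the basis; it converges when T is trace class. *)
Definition tr T : R[i] :=
  summability.sum ((fun e : H => ip H (T e) e : R[i]^o) \_ std_basis).

End HilbertSpace.

Record rootedTree := RootedTree {
  node :> choiceType;
  root : node;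
  parent : node -> node;
  parent_root : parent root = root;
  root_reached : forall v, exists n, iter n parent v == root;
  finitely_branching :
    forall w, finite_set [set v | v != root /\ parent v = w] }.

Section Tree.
Variable T : rootedTree.
Implicit Types (u v w z : T) (L : {fset T}) (N : nat).

Definition ch w : {fset T} := fset_set [set v : T | v != root T /\ parent v = w].

Definition depth v : nat := ex_minn (root_reached v).

Definition ancestor u v := exists n, iter n (@parent T) v = u.

Lemma depth_S v n : depth v = n.+1 -> v != root T /\ depth (parent v) = n.
Proof.
rewrite /depth; case: ex_minnP => m /= vm mmin; case: ex_minnP => k pk kmin mn.
subst m; split; first by apply/negP => /(mmin 0).
apply/eqP; rewrite eqn_leq kmin -?iterSr //=.
by have /mmin : iter k.+1 (@parent T) v == root T by rewrite iterSr.
Qed.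

Lemma finite_level n : finite_set [set w : T | depth w = n].
Proof.
elim: n => [|n IHn].
  apply: (sub_finite_set _ (finite_set1 (root T))) => w /=.
  by rewrite /depth; case: ex_minnP => m /= + _ m0; rewrite m0 /= => /eqP.
apply: (sub_finite_set _
    (bigcup_finite IHn (fun w _ => finitely_branching w))) => v /depth_S[vr pv].
by exists (parent v).
Qed.

Definition level n : {fset T} := fset_set [set w : T | depth w = n].

Definition active_partition N L :=
  [/\ (forall w, w \in L -> (depth w <= N)%N),
      (forall u w, u \in L -> w \in L -> ancestor u w -> u = w) &
      (forall z, depth z = N -> exists! w, w \in L /\ ancestor w z)].

Definition refinement L w : {fset T} := ((L `\ w) `|` ch w)%fset.

End Tree.

Section Energy.
Variables (R : realType) (H : hilbertType R) (T : rootedTree).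
Variable W : T -> set H.
Implicit Types (A : H -> H) (w : T) (L : {fset T}).

Definition tree_decomposition :=
  [/\ (forall w, closed_subspace (W w)),
      (forall n, orth_sum (level T n) W setT) &
      (forall w, orth_sum (ch w) W (W w))].

Definition C w A : H -> H := sqrt_op A \o proj (W w) \o sqrt_op A.

Definition M L A : R := \sum_(w <- L) hs_norm (C w A) ^+ 2.

Definition delta w A : R :=
  hs_norm (C w A) ^+ 2 - \sum_(v <- ch w) hs_norm (C v A) ^+ 2.

End Energy.

(* Main.v *)
Require Import Defs.
From mathcomp Require Import all_boot all_order all_algebra finmap complex.
From mathcomp Require Import all_classical all_reals all_analysis.
From mathcomp.analysis.showcase Require summability.
From mathcomp Require Import ring.
Set Implicit Arguments.
Unset Strict Implicit.
Unset Printing Implicit Defensive.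
Import Order.TTheory GRing.Theory Num.Theory.
Import numFieldNormedType.Exports.
Local Open Scope classical_set_scope.
Local Open Scope ring_scope.
Local Open Scope complex_scope.

(** Refining a partition at [w] replaces the term [|C_w|^2] of [M] by the terms
    [|C_v|^2], for [v] a child of [w]; the antichain condition makes sure that
    no child of [w] is already in the partition. Hence [M] drops by [delta_w]
    at each step, and the first identity is a telescoping sum.

    For the second identity it is enough to write [delta_w] with traces. Since
    [P_w] is the sum of the [P_v], [C_w] is the sum of the self-adjoint
    operators [C_v], and for each basis vector [e] the square norm [|C_w e|^2]
    is the sum of the [<C_v' e, C_v e> = <C_v C_v' e, e>] over all pairs of
    children. Summing over [e] gives [|C_w|_2^2] as the sum of the traces of
    the [C_v C_v'] ([sqr_hs_norm_sum]), and subtracting the diagonal pairs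
    leaves [delta_w] ([delta_tr]).

    This needs every [C_w] to be Hilbert-Schmidt, so that the traces converge
    unconditionally; by polarization their convergence reduces to that of
    Hilbert-Schmidt norms. Put [S = sqrt A], so that [C_w = S P_w S] and
    [A = S S]. The operators [C = S P S] and [D = S (1 - P) S] are positive
    with [C + D = A], and formally
    [|A|_2^2 = |C|_2^2 + |D|_2^2 + 2 tr (C D)] with [tr (C D) >= 0]. To avoid
    handling [tr (C D)] for operators not yet known to be Hilbert-Schmidt, this
    is done on finite sections: the matrices of [C] and [D] in finitely many
    basis vectors are Gram matrices, and the sum of the entrywise product of a
    Gram matrix with the conjugate of another one is nonnegative
    ([gram_mul_ge0]). Parseval's identity, obtained from the completeness of
    the space and the maximality of the basis, recovers the norms [|C e|] from
    the entries ([hs_norm2_compression]). *)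

(** * Inner products and Gram kernels *)

Section InnerProduct.
Variables (R : realType) (H : hilbertType R).
Implicit Types (x y z : H) (S P : H -> H).

Local Notation "<< x , y >>" := (ip H x y) (at level 0, format "<< x ,  y >>").

Lemma ipDl x y z : <<x + y, z>> = <<x, z>> + <<y, z>>.
Proof. exact: linearDl. Qed.

Lemma ipDr x y z : <<z, x + y>> = <<z, x>> + <<z, y>>.
Proof. exact: linearDr. Qed.

Lemma ipBl x y z : <<x - y, z>> = <<x, z>> - <<y, z>>.
Proof. exact: linearBl. Qed.

Lemma ipBr x y z : <<z, x - y>> = <<z, x>> - <<z, y>>.
Proof. exact: linearBr. Qed.

Lemma ipZl (a : R[i]) x y : <<a *: x, y>> = a * <<x, y>>.
Proof. exact: linearZl_LR. Qed.

Lemma ipZr (a : R[i]) x y : <<x, a *: y>> = Num.conj a * <<x, y>>.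
Proof. exact: linearZr_LR. Qed.

Lemma ipNl x y : <<- x, y>> = - <<x, y>>.
Proof. exact: linearNl. Qed.

Lemma ipNr x y : <<x, - y>> = - <<x, y>>.
Proof. exact: linearNr. Qed.

Lemma ip0l x : <<0, x>> = 0. Proof. exact: linear0l. Qed.

Lemma ip0r x : <<x, 0>> = 0. Proof. exact: linear0r. Qed.

Lemma ip_suml I (s : seq I) (F : I -> H) x :
  <<\sum_(i <- s) F i, x>> = \sum_(i <- s) <<F i, x>>.
Proof. exact: linear_sumlz. Qed.

Lemma ip_sumr I (s : seq I) (F : I -> H) x :
  <<x, \sum_(i <- s) F i>> = \sum_(i <- s) <<x, F i>>.
Proof. exact: linear_sumr. Qed.

Lemma ipC x y : <<x, y>> = Num.conj <<y, x>>.
Proof. by rewrite hermC /= expr0 mul1r. Qed.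

Lemma ip_ge0 x : 0 <= <<x, x>>.
Proof. by rewrite -ip_norm exprn_ge0. Qed.

Lemma ip_eq0 x : <<x, x>> = 0 -> x = 0.
Proof. by rewrite -ip_norm => /eqP; rewrite expf_eq0 normr_eq0 => /andP[_ /eqP]. Qed.

Lemma polarization x y :
  4 * <<x, y>> = `|x + y| ^+ 2 - `|x - y| ^+ 2
    + 'i%R * (`|x + 'i%R *: y| ^+ 2 - `|x - 'i%R *: y| ^+ 2).
Proof.
rewrite !ip_norm !ipDl !ipDr !ipNl !ipNr !ipZl !ipZr !conjCi.
have i2 : 'i%R * 'i%R = -1 :> R[i] by rewrite -expr2 sqrCi.
set a := <<x, x>>; set b := <<x, y>>; set c := <<y, x>>; set d := <<y, y>>.
transitivity (2 * (b + c) + 2 * ('i * 'i)%R * (c - b) : R[i]); last by ring.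
by rewrite i2; ring.
Qed.

(** The summand is the Gram kernel of the vectors [u i] tensor [conj (v i)], so
    the sum is a square norm in the tensor product. The induction is
    Gram-Schmidt: making all [u i] orthogonal to the first one, which then
    vanishes, splits off the square norm of a combination of the [v i]. *)
Lemma gram_mul_ge0 (I : Type) (s : seq I) (u v : I -> H) :
  0 <= \sum_(i <- s) \sum_(j <- s) <<u i, u j>> * Num.conj <<v i, v j>>.
Proof.
elim: s u => [|k s IHs] u; first by rewrite big_nil.
(* g is the normalized u k, or 0 if u k = 0. *)
have [g ugg ukg] : exists2 g : H,
    forall i, <<u i, g>> * <<g, g>> = <<u i, g>> & u k = <<u k, g>> *: g.
  have [uk0|uk0] := eqVneq `|u k| 0.
    by exists 0 => [i|]; rewrite ?ip0r ?mul0r ?scaler0//; apply/normr0_eq0.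
  exists (`|u k|^-1 *: u k) => [i|].
    rewrite !ipZl !ipZr -ip_norm (geC0_conj _) ?invr_ge0//.
    by rewrite expr2 !mulrA; field.
  rewrite ipZr -ip_norm scalerA (geC0_conj _) ?invr_ge0//.
  by rewrite (_ : _ * _ = 1) ?scale1r//; field.
pose u' i := u i - <<u i, g>> *: g.
have u'k : u' k = 0 by apply/eqP; rewrite subr_eq0 -ukg.
have uE i j : <<u i, u j>> = <<u' i, u' j>> + <<u i, g>> * Num.conj <<u j, g>>.
  rewrite /u' !ipBl !ipBr !ipZl !ipZr (ipC g (u j)); set a := <<u i, g>>.
  set b := <<u i, u j>>; set c := Num.conj <<u j, g>>.
  transitivity (b - a * c + (a * <<g, g>> - a) * c + a * c); last by ring.
  by rewrite ugg; ring.
under eq_bigr do under eq_bigr do rewrite uE mulrDl.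
under eq_bigr do rewrite big_split; rewrite big_split /=.
apply: addr_ge0.
  rewrite big_cons big1 ?add0r; last by move=> j _; rewrite u'k ip0l mul0r.
  under eq_bigr do rewrite big_cons u'k ip0r mul0r add0r.
  exact: IHs.
have -> : \sum_(i <- k :: s) \sum_(j <- k :: s)
    <<u i, g>> * Num.conj <<u j, g>> * Num.conj <<v i, v j>> =
  Num.conj <<\sum_(i <- k :: s) Num.conj <<u i, g>> *: v i,
     \sum_(j <- k :: s) Num.conj <<u j, g>> *: v j>>.
  rewrite ip_suml rmorph_sum; apply: eq_bigr => i _.
  rewrite ip_sumr rmorph_sum; apply: eq_bigr => j _.
  by rewrite ipZl ipZr !rmorphM /= !conjCK mulrA.
by rewrite geC0_conj ip_ge0.
Qed.

(** In a complex space a positive form is Hermitian: its values at [x + y] and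
    [x + i y] being real gives the two equations that identify [<S x, y>] with
    the conjugate of [<S y, x>]. *)
Lemma positive_sym S : positive_op S -> forall x y, <<S x, y>> = <<x, S y>>.
Proof.
move=> [[linS _] S_ge0] x y.
have SD u v : S (u + v) = S u + S v by have := linS 1 u v; rewrite !scale1r.
have S0 : S 0 = 0 by apply: (addIr (S 0)); rewrite -SD addr0 add0r.
have SZ a u : S (a *: u) = a *: S u by rewrite -[a *: u]addr0 linS S0 addr0.
rewrite [RHS]ipC; set a := <<S x, y>>; set b := <<S y, x>>.
have real_S u : Num.conj <<S u, u>> = <<S u, u>> by rewrite geC0_conj.
have sum_real : Num.conj a + Num.conj b = a + b.
  have := real_S (x + y); rewrite SD !ipDl !ipDr !rmorphD /= !real_S -/a -/b => E.
  apply: (addrI <<S x, x>>); apply: (addIr <<S y, y>>).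
  by rewrite -!addrA !addrA in E *; rewrite -E; ring.
have dif_real : Num.conj a - Num.conj b = b - a.
  have := real_S (x + 'i%R *: y); rewrite SD SZ !ipDl !ipDr !ipZl !ipZr.
  rewrite !rmorphD /= !rmorphM /= !conjCi !rmorphN /= !conjCi !opprK !real_S -/a -/b => E.
  have i0 : 'i%R != 0 :> R[i] := neq0Ci _.
  apply: (mulfI i0); apply: (addrI <<S x, x>>).
  apply: (addIr (- ('i * 'i * <<S y, y>>)%R)).
  transitivity (<<S x, x>> + - - 'i%R * Num.conj a
   + (- 'i%R * Num.conj b + - 'i%R * (- - 'i%R * <<S y, y>>))); first by ring.
  by rewrite opprK E; ring.
have two0 : 2 != 0 :> R[i] by rewrite pnatr_eq0.
by apply: (mulfI two0); rewrite -[LHS](_ : a + b - (b - a) = _);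
  [rewrite -sum_real -dif_real; ring | ring].
Qed.
End InnerProduct.

(** * Unconditional sums of nonnegative reals *)

#[local] Existing Instance summability.totally_filter.

Section UnconditionalSums.
Variables (R : realType) (I : choiceType).
Implicit Types (E : set I) (G : {fset I}) (f : I -> R).

Local Notation psum := (@summability.partial_sum I _).
Local Notation totally := (@summability.totally I).

Lemma psum_restrict (V : zmodType) E (f : I -> V) G :
  psum (f \_ E) G = \sum_(i <- G | i \in E) f i.
Proof.
rewrite /summability.partial_sum -(big_seq_fsetE _ _ predT (f \_ E)) /=.
by rewrite [RHS]big_mkcond; apply: eq_bigr => i _; rewrite patchE.
Qed.

Lemma sum_le_esum E f G : (forall i, 0 <= f i) ->
  ((\sum_(i <- G | i \in E) f i)%:E <= \esum_(i in E) (f i)%:E)%E.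
Proof.
move=> f0; rewrite big_fset_condE /=; set Y := [fset i in G | i \in E]%fset.
apply: esum_ge; exists [set` Y].
  by split => // i /=; rewrite !inE/= => /andP[_]; rewrite inE.
by rewrite fsbig_finite//= set_fsetK sumEFin.
Qed.

Lemma esum_le_sum E f (K : R) :
  (forall G, \sum_(i <- G | i \in E) f i <= K) ->
  (\esum_(i in E) (f i)%:E <= K%:E)%E.
Proof.
move=> fK; apply: ge_ereal_sup => _ [X [finX XE] <-].
rewrite fsbig_finite//= sumEFin lee_fin; apply: le_trans (fK (fset_set X)).
rewrite big_seq [leRHS]big_seq_cond le_eqVlt; apply/orP; left.
apply/eqP/eq_bigl => i.
rewrite in_fset_set//; apply/idP/idP => [iX|/andP[]//].
by rewrite iX/= inE; apply: XE; rewrite -in_setE.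
Qed.

Lemma cvg_psum_esum E f : (forall i, 0 <= f i) ->
  (\esum_(i in E) (f i)%:E < +oo)%E ->
  psum ((fun i => (f i)%:C : R[i]^o) \_ E) @ totally
    --> ((fine (\esum_(i in E) (f i)%:E))%:C : R[i]^o).
Proof.
move=> f0 foo; have fin : \esum_(i in E) (f i)%:E \is a fin_num.
  by rewrite ge0_fin_numE// esum_ge0// => i _; rewrite lee_fin.
set s := fine _; have sE : (s%:E = \esum_(i in E) (f i)%:E)%E by rewrite fineK.
apply/cvgrPdist_le => e e0.
have [r rE] : exists r, e = r%:C by apply/complex_realP/gtr0_real.
move: e0; rewrite {e}rE ltcR => r0.
have : ((s - r)%:E < \esum_(i in E) (f i)%:E)%E.
  by rewrite -sE lte_fin ltrBlDr ltrDl.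
move=> /ereal_sup_gt[_ [X [finX XE] <-]].
rewrite fsbig_finite//= sumEFin lte_fin => ltX.
exists (fset_set X) => // G /= XG; rewrite psum_restrict -rmorph_sum.
rewrite -rmorphB ger0_norm ?lecR ?ler0c.
  rewrite lerBlDl -lerBlDr (le_trans (ltW ltX))//.
  rewrite (eq_big_seq (fun i => if i \in X then f i else 0)); last first.
    by move=> i; rewrite in_fset_set// => ->.
  rewrite (big_fset_incl _ XG) => [|i _]; last first.
    by rewrite in_fset_set// => /negPf ->.
  rewrite [leRHS]big_mkcond; apply: ler_sum => i _.
  have [|//] := ifPn; last by case: ifP.
  by rewrite inE => /XE iE; rewrite mem_set.
by rewrite subr_ge0 -lee_fin sE sum_le_esum.
Qed.

End UnconditionalSums.

(** * Orthonormal expansions: Bessel and Parseval *)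

Section Parseval.
Variables (R : realType) (H : hilbertType R).
Implicit Types (x y z e : H) (E : set H) (G F : {fset H}).

Local Notation "<< x , y >>" := (ip H x y) (at level 0, format "<< x ,  y >>").
Local Notation totally := (@summability.totally H).

Definition orth_expansion x G : H := \sum_(e <- G) <<x, e>> *: e.

Section Orthonormal.
Variables (E : set H) (orthE : orthonormal_set E).

Lemma ip_orth_expansion x G e : [set` G] `<=` E -> e \in G ->
  <<orth_expansion x G, e>> = <<x, e>>.
Proof.
move=> GE eG; rewrite ip_suml (big_fsetD1 e eG) /= ipZl orthE.1; last exact: GE.
rewrite mulr1 big_seq big1 ?addr0// => f; rewrite !inE => /andP[fe fG].
by rewrite ipZl (orthE.2 f e (GE f fG) (GE e eG) fe) mulr0.
Qed.

Lemma sqr_norm_orth_expansion x G : [set` G] `<=` E ->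
  `|orth_expansion x G| ^+ 2 = \sum_(e <- G) `|<<x, e>>| ^+ 2.
Proof.
move=> GE; rewrite ip_norm {2}/orth_expansion ip_sumr.
rewrite big_seq [RHS]big_seq; apply: eq_bigr => e eG.
by rewrite ipZr ip_orth_expansion// mulrC normCK.
Qed.

Lemma sqr_norm_sub_orth_expansion x G : [set` G] `<=` E ->
  `|x - orth_expansion x G| ^+ 2 = `|x| ^+ 2 - \sum_(e <- G) `|<<x, e>>| ^+ 2.
Proof.
move=> GE; rewrite -(sqr_norm_orth_expansion x GE) !ip_norm ipBr !ipBl.
set p := orth_expansion x G.
have xp : <<x, p>> = <<p, p>>.
  rewrite {2 3}/p /orth_expansion !ip_sumr big_seq [RHS]big_seq.
  by apply: eq_bigr => e eG; rewrite !ipZr ip_orth_expansion.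
by rewrite xp [<<p, x>>]ipC xp geC0_conj ?ip_ge0// subrr subr0.
Qed.

Lemma bessel x G : [set` G] `<=` E ->
  \sum_(e <- G) `|<<x, e>>| ^+ 2 <= `|x| ^+ 2.
Proof.
by move=> GE; rewrite -subr_ge0 -sqr_norm_sub_orth_expansion ?exprn_ge0.
Qed.

Lemma norm_ip_le x e : E e -> `|<<x, e>>| <= `|x|.
Proof.
move=> Ee; rewrite -(@ler_pXn2r _ 2) ?nnegrE//.
have := @bessel x [fset e]%fset; rewrite big_seq_fset1; apply=> f /=.
by rewrite inE => /eqP ->.
Qed.

End Orthonormal.

(** The partial sums of the squared coefficients converge, being bounded by
    Bessel's inequality, and their increments are the squared distances between
    the expansions, which therefore form a Cauchy net. *)
Lemma orth_expansion_cvg E x : orthonormal_set E ->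
  cvg ((fun G => orth_expansion x [fset e in G | e \in E]%fset) @ totally).
Proof.
move=> oE; set y := fun G : {fset H} => _.
have nE G : [set` [fset e in G | e \in E]%fset] `<=` E.
  by move=> e /=; rewrite !inE => /andP[_]; rewrite inE.
pose f e := complex.Re (`|<<x, e>>| ^+ 2).
have fE e : (f e)%:C = `|<<x, e>>| ^+ 2 by rewrite /f RRe_real// ger0_real ?exprn_ge0.
have f0 e : 0 <= f e by rewrite -lecR fE exprn_ge0.
have sumf G : (\sum_(e <- G | e \in E) f e)%:C = `|y G| ^+ 2.
  rewrite (sqr_norm_orth_expansion oE x (@nE G)) rmorph_sum -big_fset_condE.
  by apply: eq_bigr => e _; exact: fE.
have foo : (\esum_(e in E) (f e)%:E < +oo)%E.
  apply: (@le_lt_trans _ _ (complex.Re (`|x| ^+ 2))%:E); last exact: ltry.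
  apply: esum_le_sum => G; rewrite -lecR sumf RRe_real ?ger0_real ?exprn_ge0//.
  by rewrite (sqr_norm_orth_expansion oE x (@nE G)) (bessel oE).
apply/cauchy_cvgP/cauchy_exP => _/posnumP[d].
have d4 : 0 < d%:num ^+ 2 / 4 :> R[i] by rewrite divr_gt0// exprn_gt0.
have /cvgrPdist_le /(_ _ d4)[G0 _ cvgG0] := cvg_psum_esum f0 foo.
exists (y G0), G0 => // G /= G0G.
rewrite -ball_normE /= -(@ltr_pXn2r _ 2) ?nnegrE// distrC.
have yG0 : y G0 = orth_expansion (y G) [fset e in G0 | e \in E]%fset.
  rewrite [RHS]big_seq [LHS]big_seq; apply: eq_bigr => e.
  rewrite !inE => /andP[eG0 eE]; congr (_ *: _); symmetry.
  apply: (ip_orth_expansion oE x (@nE G)).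
  by rewrite !inE eE (fsubsetP G0G).
have -> : `|y G - y G0| ^+ 2 = `|y G| ^+ 2 - `|y G0| ^+ 2.
  by rewrite {1}yG0 (sqr_norm_sub_orth_expansion oE _ (@nE G0))
    -(sqr_norm_orth_expansion oE _ (@nE G0)) -yG0.
rewrite -!sumf; have := cvgG0 G0 (fsubset_refl _); have := cvgG0 _ G0G.
rewrite !psum_restrict -!rmorph_sum /=.
set s := _%:C; set a := \sum_(e <- G | _) f e; set b := \sum_(e <- G0 | _) f e.
move=> sa sb; have ab : a%:C - b%:C \is Num.real.
  by rewrite -rmorphB; apply/complex_realP; exists (a - b).
apply: (le_lt_trans (real_ler_norm ab)).
apply: (le_lt_trans (ler_distD s _ _)); rewrite (distrC a%:C).
apply: (le_lt_trans (lerD sa sb)); rewrite -mulrDr -[ltRHS]mulr1.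
rewrite ltr_pM2l ?exprn_gt0//.
have -> : 4^-1 + 4^-1 = 2^-1 :> R[i] by field.
by rewrite invf_lt1// ltr1n.
Qed.

(** Bessel's inequality is an equality for a maximal orthonormal set: the
    expansions converge by completeness, and the difference of [x] with their
    limit is orthogonal to the basis. *)
Lemma parseval_approx E x (d : R[i]) : hilbert_basis E -> 0 < d ->
  exists2 G : {fset H}, [set` G] `<=` E &
    `|x| ^+ 2 <= \sum_(e <- G) `|<<x, e>>| ^+ 2 + d.
Proof.
move=> [oE maxE] d0; have := @orth_expansion_cvg E x oE.
set y := fun G : {fset H} => _; move=> /cvg_ex[/= l cvgl].
have nE G : [set` [fset e in G | e \in E]%fset] `<=` E.
  by move=> e /=; rewrite !inE => /andP[_]; rewrite inE.
have {cvgl} near_l r : 0 < r -> exists G, forall F, (G `<=` F)%fset -> `|l - y F| < r.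
  by move=> r0; have /cvgrPdist_lt /(_ _ r0)[G _ lG] := cvgl; exists G.
have xl : x = l.
  apply/eqP; rewrite -subr_eq0; apply/eqP/maxE => e Ee.
  apply/eqP/negPn/negP => ne0; have := ne0; rewrite -normr_gt0 => /near_l[G].
  move=> /(_ (e |` G)%fset (fsubsetU1 _ _)).
  suff -> : <<x - l, e>> = <<y (e |` G)%fset - l, e>>.
    by rewrite distrC => /lt_le_trans/(_ (norm_ip_le oE _ Ee)); rewrite ltxx.
  rewrite !ipBl (ip_orth_expansion oE x (@nE _))// !inE eqxx/=.
  by rewrite mem_set.
have /near_l[G /(_ G (fsubset_refl _)) lG] : 0 < sqrtC d by rewrite sqrtC_gt0.
exists [fset e in G | e \in E]%fset => //.
rewrite -lerBlDl -(sqr_norm_sub_orth_expansion oE x (@nE G)) {1}xl.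
by rewrite -[leRHS]sqrtCK ler_pXn2r ?nnegrE ?sqrtC_ge0 ?(ltW d0)//; exact: ltW.
Qed.

End Parseval.

(** * The Hilbert-Schmidt norm and compressions *)

Section HilbertSchmidt.
Variables (R : realType) (H : hilbertType R).
Implicit Types (x y z e : H) (E : set H) (G F : {fset H}) (S P T : H -> H).

Local Notation "<< x , y >>" := (ip H x y) (at level 0, format "<< x ,  y >>").
Local Notation psum := (@summability.partial_sum H _).
Local Notation totally := (@summability.totally H).
Local Notation basis := (@std_basis R H).

Lemma std_basisP : hilbert_basis basis.
Proof. exact: projT2 (cid (hilbert_basis_exists H)). Qed.

Lemma ler_sum_fset (K : numDomainType) (I : choiceType) (A B : {fset I})
    (f : I -> K) : (forall i, 0 <= f i) -> (A `<=` B)%fset ->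
  \sum_(i <- A) f i <= \sum_(i <- B) f i.
Proof.
move=> f0 AB; rewrite (eq_big_seq (fun i => if i \in A then f i else 0)).
  rewrite (big_fset_incl _ AB) => [|i _ /negPf ->//].
  by apply: ler_sum => i _; case: ifP.
by move=> i ->.
Qed.

Lemma sqr_norm_Re x : (complex.Re (`|x| ^+ 2))%:C = `|x| ^+ 2.
Proof. by rewrite RRe_real// ger0_real ?exprn_ge0. Qed.

Lemma Re_sqr_norm_ge0 x : 0 <= complex.Re (`|x| ^+ 2).
Proof. by rewrite -lecR sqr_norm_Re exprn_ge0. Qed.

Lemma hs_norm2_ge0 T : (0 <= hs_norm2 T)%E.
Proof. by apply: esum_ge0 => e _; rewrite lee_fin Re_sqr_norm_ge0. Qed.

Lemma hs_norm2_fin T : (hs_norm2 T < +oo)%E -> hs_norm2 T = (fine (hs_norm2 T))%:E.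
Proof. by move=> Too; rewrite fineK// ge0_fin_numE ?hs_norm2_ge0. Qed.

Lemma sqr_hs_norm T : hs_norm T ^+ 2 = fine (hs_norm2 T).
Proof. by rewrite sqr_sqrtr// fine_ge0 ?hs_norm2_ge0. Qed.

Lemma hs_norm2_le T (K : R) :
  (forall G, [set` G] `<=` basis -> \sum_(e <- G) `|T e| ^+ 2 <= K%:C) ->
  (hs_norm2 T <= K%:E)%E.
Proof.
move=> TK; apply: esum_le_sum => G; rewrite -lecR big_fset_condE rmorph_sum.
under eq_bigr do rewrite /= sqr_norm_Re.
by apply: TK => e /=; rewrite !inE => /andP[_]; rewrite inE.
Qed.

Lemma sum_le_hs_norm2 T G : (hs_norm2 T < +oo)%E -> [set` G] `<=` basis ->
  \sum_(e <- G) `|T e| ^+ 2 <= (fine (hs_norm2 T))%:C.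
Proof.
move=> Too GE; have := sum_le_esum basis G (fun e => Re_sqr_norm_ge0 (T e)).
rewrite -/(hs_norm2 T) (hs_norm2_fin Too) lee_fin -lecR rmorph_sum.
apply: le_trans; rewrite big_seq [leRHS]big_seq_cond.
rewrite le_eqVlt; apply/orP; left; apply/eqP.
apply: eq_big => [e|e _]; last by rewrite /= sqr_norm_Re.
by case: (boolP (e \in G)) => //= eG; rewrite mem_set//; exact: GE.
Qed.

Lemma hs_norm2_cvg T : (hs_norm2 T < +oo)%E ->
  psum ((fun e => `|T e| ^+ 2 : R[i]^o) \_ basis) @ totally
    --> ((hs_norm T ^+ 2)%:C : R[i]^o).
Proof.
move=> Too; rewrite sqr_hs_norm.
under [X in X \_ _]eq_fun do rewrite -sqr_norm_Re.
exact: cvg_psum_esum (fun e => Re_sqr_norm_ge0 (T e)) Too.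
Qed.

(** The union of the sets that [parseval_approx] gives for the single vectors,
    with the error [d] halved from one vector to the next. *)
Lemma parseval_approx_seq E (s : seq H) (d : R[i]) : hilbert_basis E -> 0 < d ->
  exists2 F : {fset H}, [set` F] `<=` E &
    \sum_(x <- s) `|x| ^+ 2 <= \sum_(x <- s) \sum_(f <- F) `|<<x, f>>| ^+ 2 + d.
Proof.
move=> EP; elim: s d => [|x s IHs] d d0.
  by exists fset0 => [f|]; rewrite ?big_nil ?add0r ?ltW//= inE.
have d2 : 0 < d / 2 by rewrite divr_gt0.
have [F FE sF] := IHs _ d2; have [G GE xG] := parseval_approx x EP d2.
exists (F `|` G)%fset.
  by move=> f /=; rewrite inE => /orP[/FE//|/GE].
rewrite !big_cons (splitr d) addrACA; apply: lerD.
  apply: le_trans xG _; rewrite lerD2r; apply: ler_sum_fset; last exact: fsubsetUr.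
  by move=> f; rewrite exprn_ge0.
apply: le_trans sF _; rewrite lerD2r; apply: ler_sum => y _.
apply: ler_sum_fset; last exact: fsubsetUl.
by move=> f; rewrite exprn_ge0.
Qed.

Section Compression.
Variables (S P : H -> H).
Hypothesis symS : forall x y, <<S x, y>> = <<x, S y>>.
Hypothesis projP : forall x y, <<P x, y>> = <<P x, P y>>.

(** With [c] and [d] the Gram matrices of the [P S e] and of the [S e - P S e],
    the entries on the right are those of [c + d], and the cross terms in the
    sum of the [|c + d|^2] are nonnegative by [gram_mul_ge0]. *)
Lemma sum_compression_le G :
  \sum_(e <- G) \sum_(f <- G) `|<<(S \o P \o S) e, f>>| ^+ 2 <=
  \sum_(e <- G) \sum_(f <- G) `|<<(S \o S) e, f>>| ^+ 2.
Proof.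
pose c e f := <<P (S e), P (S f)>>.
pose d e f := <<S e - P (S e), S f - P (S f)>>.
have cE e f : <<(S \o P \o S) e, f>> = c e f by rewrite /= symS projP.
have aE e f : <<(S \o S) e, f>> = c e f + d e f.
  rewrite /= symS /c /d !ipBl !ipBr (projP (S e) (S f)) [<<S e, P _>>]ipC.
  by rewrite (projP (S f) (S e)) -ipC; ring.
pose g := \sum_(e <- G) \sum_(f <- G) c e f * Num.conj (d e f).
have g0 : 0 <= g by exact: gram_mul_ge0.
have -> : \sum_(e <- G) \sum_(f <- G) `|<<(S \o S) e, f>>| ^+ 2 =
    \sum_(e <- G) \sum_(f <- G) `|<<(S \o P \o S) e, f>>| ^+ 2 +
    \sum_(e <- G) \sum_(f <- G) `|d e f| ^+ 2 + g + Num.conj g.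
  rewrite /g rmorph_sum -!big_split; apply: eq_bigr => e _.
  rewrite rmorph_sum -!big_split; apply: eq_bigr => f _ /=.
  rewrite aE cE !normCK rmorphD rmorphM /= conjCK; ring.
rewrite -!addrA lerDl addr_ge0//; last by rewrite addr_ge0// conjC_ge0.
by do 2!apply: sumr_ge0 => ? _; rewrite exprn_ge0.
Qed.

(** As [S P S <= S S], this is an instance of the monotonicity of the
    Hilbert-Schmidt norm on positive operators, which [sum_compression_le]
    shows on finite sections. The error allowed in Parseval's identity may be
    any constant, here 1, because only finiteness is claimed. *)
Lemma hs_norm2_compression : (hs_norm2 (S \o S) < +oo)%E ->
  (hs_norm2 (S \o P \o S) < +oo)%E.
Proof.
move=> Soo; apply: (@le_lt_trans _ _ (fine (hs_norm2 (S \o S)) + 1)%:E); last exact: ltry.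
apply: hs_norm2_le => G GE; set C := S \o P \o S.
have [F FE] := parseval_approx_seq [seq C e | e <- G] std_basisP ltr01.
rewrite !big_map => /le_trans; apply; rewrite rmorphD rmorph1 lerD2r.
have GFE : [set` (G `|` F)%fset] `<=` basis.
  by move=> f /=; rewrite inE => /orP[/GE|/FE].
apply: le_trans (sum_le_hs_norm2 Soo GFE).
apply: le_trans (_ : \sum_(e <- (G `|` F)%fset) \sum_(f <- (G `|` F)%fset)
  `|<<(S \o S) e, f>>| ^+ 2 <= _); last first.
  by apply: ler_sum => e _; apply: (bessel std_basisP.1).
apply: le_trans (sum_compression_le _).
apply: le_trans (_ : \sum_(e <- G) \sum_(f <- (G `|` F)%fset) `|<<C e, f>>| ^+ 2 <= _).
  apply: ler_sum => e _; apply: ler_sum_fset; last exact: fsubsetUr.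
  by move=> f; rewrite exprn_ge0.
apply: ler_sum_fset; last exact: fsubsetUl.
by move=> e; apply: sumr_ge0 => f _; rewrite exprn_ge0.
Qed.

End Compression.

End HilbertSchmidt.

(** * Convergence of traces *)

(** The right-hand side of [polarization], with four convergent nets in place
    of the square norms. *)
Lemma is_cvg_polarization (K : numFieldType) (I : Type) (F : set_system I)
    (k l : K) (a b c d : I -> K^o) : Filter F ->
  cvg (a @ F) -> cvg (b @ F) -> cvg (c @ F) -> cvg (d @ F) ->
  cvg ((fun i => k * (a i - b i + l * (c i - d i)) : K^o) @ F).
Proof.
move=> FF ca cb cc cd; apply: (@is_cvgZl_tmp _ K^o).
by apply: is_cvgD; [exact: is_cvgB|apply: is_cvgZl_tmp; exact: is_cvgB].
Qed.

Section Trace.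
Variables (R : realType) (H : hilbertType R).
Implicit Types (x y z e : H) (C D T U V : H -> H).

Local Notation "<< x , y >>" := (ip H x y) (at level 0, format "<< x ,  y >>").
Local Notation psum := (@summability.partial_sum H _).
Local Notation totally := (@summability.totally H).
Local Notation basis := (@std_basis R H).

(** From [(a + b)^2 <= 2 a^2 + 2 b^2]. *)
Lemma hs_norm2_addZ U V (a : R[i]) : `|a| = 1 ->
  (hs_norm2 U < +oo)%E -> (hs_norm2 V < +oo)%E ->
  (hs_norm2 (fun e => (U e + a *: V e)%R) < +oo)%E.
Proof.
move=> a1 Uoo Voo.
apply: (@le_lt_trans _ _
  (2 * fine (hs_norm2 U) + 2 * fine (hs_norm2 V))%:E); last exact: ltry.
apply: hs_norm2_le => G GE.
apply: (@le_trans _ _ (\sum_(e <- G) (2 * `|U e| ^+ 2 + 2 * `|V e| ^+ 2))).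
  apply: ler_sum => e _; apply: (@le_trans _ _ ((`|U e| + `|V e|) ^+ 2)).
    rewrite ler_pXn2r ?nnegrE ?addr_ge0//.
    by rewrite (le_trans (ler_normD _ _))// normrZ a1 mul1r.
  rewrite -subr_ge0.
  have -> : 2 * `|U e| ^+ 2 + 2 * `|V e| ^+ 2 - (`|U e| + `|V e|) ^+ 2
    = (`|U e| - `|V e|) ^+ 2 by ring.
  by rewrite real_exprn_even_ge0// realB ?normr_real.
rewrite big_split /= -!mulr_sumr rmorphD !rmorphM /= rmorph_nat.
by apply: lerD; rewrite ler_pM2l//; apply: sum_le_hs_norm2.
Qed.

Lemma is_cvg_psum_ip U V :
  (hs_norm2 U < +oo)%E -> (hs_norm2 V < +oo)%E ->
  cvg (psum ((fun e => <<U e, V e>> : R[i]^o) \_ basis) @ totally).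
Proof.
move=> Uoo Voo.
pose q (a : R[i]) : {fset H} -> R[i]^o :=
  psum ((fun e => `|U e + a *: V e| ^+ 2 : R[i]^o) \_ basis).
have cvgq (a : R[i]) : `|a| = 1 -> cvg (q a @ totally).
  by move=> a1; apply/cvg_ex; eexists; apply: hs_norm2_cvg (hs_norm2_addZ a1 Uoo Voo).
have -> : psum ((fun e => <<U e, V e>> : R[i]^o) \_ basis) =
    (fun G => 4^-1 * (q 1 G - q (- 1) G + 'i%R * (q 'i%R G - q (- 'i%R) G))).
  apply/funext => G; rewrite /q !psum_restrict -!sumrB mulr_sumr -big_split.
  rewrite mulr_sumr; apply: eq_bigr => e _ /=; rewrite scale1r scaleN1r scaleNr.
  by rewrite -polarization; field.
have cq1 := cvgq 1 (normr1 _); have cqN1 := cvgq (- 1) (normrN1 _).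
have cqi := cvgq 'i%R (normCi _).
have cqNi : cvg (q (- 'i%R) @ totally) by apply: cvgq; rewrite normrN normCi.
move: (q 1) (q (-1)) (q 'i%R) (q (- 'i%R)) cq1 cqN1 cqi cqNi.
move=> q1 q2 q3 q4 c1 c2 c3 c4.
exact: (is_cvg_polarization _ c1 c2 c3 c4).
Qed.

Lemma psum_ip_cvg_tr C D : (forall x y, <<C x, y>> = <<x, C y>>) ->
  (hs_norm2 C < +oo)%E -> (hs_norm2 D < +oo)%E ->
  psum ((fun e => <<D e, C e>> : R[i]^o) \_ basis) @ totally --> (tr (C \o D) : R[i]^o).
Proof.
move=> symC Coo Doo; rewrite /tr /summability.sum /=.
have -> : (fun e => <<C (D e), e>> : R[i]^o) = (fun e => <<D e, C e>>).
  by apply/funext => e; rewrite symC.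
exact: is_cvg_psum_ip.
Qed.

(** On finite sets of basis vectors, expanding [|T e|^2] gives the sum of the
    [<C_j e, C_i e>]; the limit may be taken term by term because each trace
    converges separately. *)
Lemma sqr_hs_norm_sum (I : Type) (s : seq I) (C : I -> H -> H) T :
  (forall i x y, <<C i x, y>> = <<x, C i y>>) ->
  (forall i, (hs_norm2 (C i) < +oo)%E) -> (hs_norm2 T < +oo)%E ->
  (forall x, T x = \sum_(i <- s) C i x) ->
  (hs_norm T ^+ 2)%:C = \sum_(i <- s) \sum_(j <- s) tr (C i \o C j).
Proof.
move=> symC Coo Too TE.
have cvgT := hs_norm2_cvg Too.
have addc : continuous (fun z : R[i]^o * R[i]^o => z.1 + z.2).
  exact: add_continuous.
have cvgC : \sum_(i <- s) \sum_(j <- s)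
    psum ((fun e => <<C j e, C i e>> : R[i]^o) \_ basis) G @[G --> totally]
    --> (\sum_(i <- s) \sum_(j <- s) tr (C i \o C j) : R[i]^o).
  apply: (cvg_big addc) => i _; apply: (cvg_big addc) => j _.
  exact: psum_ip_cvg_tr.
have psumE : psum ((fun e => `|T e| ^+ 2 : R[i]^o) \_ basis) =
    (fun G => \sum_(i <- s) \sum_(j <- s)
      psum ((fun e => <<C j e, C i e>> : R[i]^o) \_ basis) G).
  apply/funext => G; rewrite psum_restrict.
  under [RHS]eq_bigr do under eq_bigr do rewrite psum_restrict.
  under [RHS]eq_bigr do rewrite exchange_big.
  rewrite exchange_big; apply: eq_bigr => e _ /=.
  rewrite ip_norm TE ip_suml exchange_big; apply: eq_bigr => i _.
  by rewrite ip_sumr.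
rewrite psumE in cvgT.
exact: cvg_unique cvgT cvgC.
Qed.

End Trace.

(** * Projections and the operators attached to the nodes *)

Section Projections.
Variables (R : realType) (H : hilbertType R).
Implicit Types (x y z p : H) (U : set H).

Local Notation "<< x , y >>" := (ip H x y) (at level 0, format "<< x ,  y >>").

Local Notation proj := Defs.proj.

Definition is_proj U x p := U p /\ forall z, U z -> <<x - p, z>> = 0.

Lemma closed_subspaceB U x y : closed_subspace U -> U x -> U y -> U (x - y).
Proof. by move=> [_ linU _] Ux Uy; rewrite addrC -scaleN1r; exact: linU. Qed.

Lemma is_proj_unique U x p q : closed_subspace U ->
  is_proj U x p -> is_proj U x q -> p = q.
Proof.
move=> subU [Up px] [Uq qx]; have Upq := closed_subspaceB subU Up Uq.
apply/eqP; rewrite -subr_eq0; apply/eqP/ip_eq0.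
have -> : <<p - q, p - q>> = <<x - q, p - q>> - <<x - p, p - q>>.
  by rewrite -ipBl opprB [x - q + _]addrC addrA addrNK.
by rewrite px// qx// subrr.
Qed.

Lemma proj_unique U x p : closed_subspace U -> is_proj U x p -> proj U x = p.
Proof.
move=> subU px; apply: (is_proj_unique subU _ px).
by rewrite /proj; case: xgetP => [q _ //|/(_ p)].
Qed.

Lemma orth_sum_is_proj (I : choiceType) (s : {fset I}) (W : I -> set H) V x i :
  (forall i, closed_subspace (W i)) -> orth_sum s W V -> i \in s -> V x ->
  exists2 y : I -> H, x = \sum_(j <- s) y j & forall i, i \in s -> is_proj (W i) x (y i).
Proof.
move=> subW [orthW ->] iS [y [Wy xE]]; exists y => // {i}j {}iS.
split=> [|z Wz]; first exact: Wy.
rewrite xE (big_fsetD1 j iS) /= addrAC subrr add0r ip_suml big_seq big1// => k.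
by rewrite !inE => /andP[kj ks]; apply: (orthW k j) => //; exact: Wy.
Qed.

End Projections.

Section Energy.
Variables (R : realType) (H : hilbertType R) (T : rootedTree).
Variables (W : T -> set H) (hW : tree_decomposition W).
Implicit Types (x y z : H) (v w : T) (A : H -> H).

Local Notation "<< x , y >>" := (ip H x y) (at level 0, format "<< x ,  y >>").

Local Notation proj := Defs.proj.

(** The projection on [W w] is read off the decomposition of the whole space
    along the level of [w]. *)
Lemma proj_node w x : is_proj (W w) x (proj (W w) x).
Proof.
have [subW lvl _] := hW.
have wl : w \in level T (depth w).
  by rewrite in_fset_set ?inE//; exact: finite_level.
have [y _ py] := orth_sum_is_proj subW (lvl (depth w)) wl (I : [set: H] x).
by rewrite (proj_unique (subW w) (py _ wl)); exact: py.
Qed.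

Lemma ip_proj w x y : <<proj (W w) x, y>> = <<proj (W w) x, proj (W w) y>>.
Proof.
have [Wx _] := proj_node w x; have [_ py] := proj_node w y.
apply/eqP; rewrite -subr_eq0 -ipBr; apply/eqP.
by rewrite ipC py// rmorph0.
Qed.

(** The component in [W v] of the projection on [W w] satisfies the defining
    property of the projection on [W v]: what is removed is orthogonal to
    [W w], which contains [W v], or lies in the other children. *)
Lemma proj_children w x : proj (W w) x = \sum_(v <- ch w) proj (W v) x.
Proof.
have [subW _ dec] := hW; have [Wp px] := proj_node w x.
have [orthW WwE] := dec w.
move: (Wp); rewrite {1}WwE => -[y [Wy pE]]; rewrite [LHS]pE.
rewrite big_seq [RHS]big_seq; apply: eq_bigr => v vw; symmetry.
apply: proj_unique => //; split=> [|z Wz]; first exact: Wy.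
have Wwz : W w z.
  rewrite WwE; exists (fun u => if u == v then z else 0); split=> [u uw|].
    by case: eqP => [->//|_]; have [] := subW u.
  rewrite (big_fsetD1 v vw) /= eqxx big_seq big1 ?addr0// => u.
  by rewrite !inE => /andP[/negPf ->].
rewrite -[x](subrK (proj (W w) x)) -addrA ipDl px// add0r pE.
rewrite (big_fsetD1 v vw) /= addrAC subrr add0r ip_suml big_seq big1// => u.
by rewrite !inE => /andP[uv us]; apply: (orthW u v) => //; exact: Wy.
Qed.

(** Holds for both values that [sqrt_op A] can take: a positive square root of
    [A], or the default value 0. *)
Lemma sqrt_op_hs A : hilbert_schmidt A ->
  positive_op (sqrt_op A) /\ (hs_norm2 (sqrt_op A \o sqrt_op A) < +oo)%E.
Proof.
move=> [_ Aoo]; rewrite /sqrt_op; case: xgetP => [S _ [posS ->]//|_].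
split; last first.
  by rewrite /hs_norm2 esum1 ?ltry// => e _; rewrite /= normr0 expr0n.
split=> [|x]; last by rewrite ip0l.
by split=> [a x y|]; [rewrite scaler0 addr0|exists 0 => x; rewrite normr0 mul0r].
Qed.

Variables (A : H -> H) (hA2 : hilbert_schmidt A).

Lemma sqrt_op_sum I (s : seq I) (F : I -> H) :
  sqrt_op A (\sum_(i <- s) F i) = \sum_(i <- s) sqrt_op A (F i).
Proof.
have [[[linS _] _] _] := sqrt_op_hs hA2.
have SD x y : sqrt_op A (x + y) = sqrt_op A x + sqrt_op A y.
  by have := linS 1 x y; rewrite !scale1r.
apply: (big_morph _ SD); apply: (addIr (sqrt_op A 0)).
by rewrite -SD addr0 add0r.
Qed.

Lemma C_sum w x : C W w A x = \sum_(v <- ch w) C W v A x.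
Proof. by rewrite /C /= proj_children sqrt_op_sum. Qed.

Lemma C_sym w x y : <<C W w A x, y>> = <<x, C W w A y>>.
Proof.
have [posS _] := sqrt_op_hs hA2; have symS := positive_sym posS.
by rewrite /C /= symS -[RHS]symS ip_proj [RHS]ipC
  [X in _ = Num.conj X]ip_proj -ipC.
Qed.

Lemma C_hs w : (hs_norm2 (C W w A) < +oo)%E.
Proof.
have [posS Soo] := sqrt_op_hs hA2.
exact: (hs_norm2_compression (positive_sym posS) (ip_proj w) Soo).
Qed.

Lemma delta_tr w : (delta W w A)%:C =
  \sum_(v <- ch w) \sum_(v' <- ch w | v != v') tr (C W v A \o C W v' A).
Proof.
rewrite /delta rmorphB rmorph_sum /=.
rewrite (sqr_hs_norm_sum C_sym C_hs (C_hs w) (C_sum w)) -sumrB.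
rewrite big_seq [RHS]big_seq; apply: eq_bigr => v vw.
rewrite (@sqr_hs_norm_sum _ _ _ [:: v] (fun v => C W v A)) ?big_seq1//.
- rewrite (bigD1_seq v vw (fset_uniq _)) /= addrAC subrr add0r.
  by apply: eq_bigl => v'; rewrite eq_sym.
- exact: C_sym.
- exact: C_hs.
- exact: C_hs.
- by move=> x; rewrite big_seq1.
Qed.

End Energy.

(** * Refinements and the energy balance *)

Section Tree.
Variable T : rootedTree.
Implicit Types (v w : T) (L : {fset T}).

Lemma mem_ch v w : (v \in ch w) = (v != Defs.root T) && (parent v == w).
Proof.
rewrite in_fset_set; last exact: finitely_branching.
by apply/idP/andP; rewrite inE /= => -[? /eqP]; split.
Qed.

(** Iterating [parent] from a fixed point other than the root would never reach
    the root. *)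
Lemma parent_neq v : v != Defs.root T -> parent v != v.
Proof.
move=> vr; apply/negP => /eqP pv; have [n] := root_reached v.
by rewrite (_ : iter n _ v = v) ?(negPf vr)//; elim: n => //= n ->.
Qed.

(** A child of [w] in [L] would be a proper descendant of [w], against the
    antichain condition. *)
Lemma active_ch_disjoint N L w : active_partition N L -> w \in L ->
  [disjoint L & ch w]%fset.
Proof.
move=> [_ anti _] wL; apply/fdisjointP => v vL; rewrite mem_ch negb_and.
have [//|vr /=] := eqVneq v (Defs.root T); apply/eqP => pv.
have wv : w = v by apply: anti => //; exists 1%N.
by have := parent_neq vr; rewrite pv wv eqxx.
Qed.

End Tree.

Lemma sum_fsetU_disjoint (V : nmodType) (I : choiceType) (A B : {fset I})
    (f : I -> V) : [disjoint A & B]%fset ->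
  \sum_(i <- (A `|` B)%fset) f i = \sum_(i <- A) f i + \sum_(i <- B) f i.
Proof.
move=> /fdisjointP AB; rewrite -big_cat; apply: perm_big; apply: uniq_perm.
- exact: fset_uniq.
- rewrite cat_uniq !fset_uniq andbT /=; apply/hasPn => i iB.
  by apply: contraL iB; exact: AB.
- by move=> i; rewrite mem_cat inE.
Qed.

Lemma M_refinement (R : realType) (H : hilbertType R) (T : rootedTree)
    (W : T -> set H) (A : H -> H) (N : nat) (L : {fset T}) (w : T) :
  active_partition N L -> w \in L ->
  M W L A - M W (refinement L w) A = delta W w A.
Proof.
move=> actL wL; rewrite /M /refinement /delta (big_fsetD1 w wL) sum_fsetU_disjoint /=.
  by rewrite opprD addrA addrK.
by apply: fdisjointWl (active_ch_disjoint actL wL); exact: fsubsetDl.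
Qed.

Theorem corollary6p5 (R : realType) (H : hilbertType R) (T : rootedTree)
    (W : T -> set H) (hW : tree_decomposition W)
    (N : nat) (hN : (1 <= N)%N)
    (m : nat) (L : nat -> {fset T}) (w : nat -> T)
    (hL : forall j, (j <= m)%N -> active_partition N (L j))
    (hw : forall j, (1 <= j <= m)%N ->
       [/\ w j \in L j.-1, (depth (w j) < N)%N &
           L j = refinement (L j.-1) (w j)])
    (A : H -> H) (hA : positive_op A) (hA2 : hilbert_schmidt A) :
  M W (L 0%N) A - M W (L m) A = \sum_(1 <= j < m.+1) delta W (w j) A
  /\
  (M W (L 0%N) A - M W (L m) A)%:C =
    \sum_(1 <= j < m.+1) \sum_(v <- ch (w j))
      \sum_(v' <- ch (w j) | v != v') tr (C W v A \o C W v' A).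
Proof.
have telescope :
    M W (L 0%N) A - M W (L m) A = \sum_(1 <= j < m.+1) delta W (w j) A.
  rewrite -opprB -(telescope_sumr (fun j => M W (L j) A))// big_add1 /= -sumrN.
  apply: eq_big_nat => j /andP[_ jm].
  have [wL _ ->] := hw j.+1 jm.
  by rewrite opprB (M_refinement W A (hL _ (ltnW jm)) wL).
split=> //; rewrite telescope rmorph_sum; apply: eq_bigr => j _.
exact: delta_tr.
Qed.
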